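(* Let $k\ge1$ and let $v_1,\dots,v_n\in\mathbb{R}^d$ be an arbitrary (fixed) sequence of $n$ vectors containing at least $k+1$ distinct vectors, and let $W^*$ be the optimal $k$-means cost of this multiset. Run the fully online $k$-means algorithm (described in the context) on the sequence, and let $W=\sum_{t=1}^n\|v_t-c_t\|^2$ be the cost of its online assignments, where $c_t$ is the center output for $v_t$ at the time $v_t$ is processed. Then $$\mathbb{E}[W]=O(W^*\log n),$$ where the expectation is over the algorithm's internal randomness and the constant in $O(\cdot)$ is absolute.
   Context: Norms are Euclidean, and $\log$ denotes the base-2 logarithm. The optimal $k$-means cost of vectors $v_1,\dots,v_n$ is $W^*=\min\sum_{i=1}^k\sum_{v\in S_i}\|v-c_i\|_2^2$, the minimum taken over all partitions of the vectors into $k$ sets $S_1,\dots,S_k$ and all choices of centers $c_1,\dots,c_k\in\mathbb{R}^d$. For a point $v$ and a finite set $C$, $D(v,C)=\min_{c\in C}\|v-c\|$. Fully online $k$-means algorithm (input: the stream and $k$; the length of the stream is not known to it): let $C$ be the set of the first $k+1$ distinct vectors of the stream, each of which is output as its own center, and set a counter $m\gets k+1$. Set $w^*\gets\min_{v\ne v'\in C}\|v-v'\|^2/2$, $r\gets1$, $q_1\gets0$, $f_1\gets w^*/k$. For each remaining vector $v$ of the stream, in order: set $m\gets m+1$; with probability $p=\min(D^2(v,C)/f_r,1)$ (independently of all other random choices), set $C\gets C\cup\{v\}$ and $q_r\gets q_r+1$; then, if $q_r\ge 3k(1+\log m)$, set $r\gets r+1$, $q_r\gets0$, $f_r\gets2f_{r-1}$;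 finally output (assign $v$ to) the center $c=\arg\min_{c\in C}\|v-c\|^2$. *)

(* Defs.v *)
From HB Require Import structures.
From mathcomp Require Import all_boot all_order all_algebra.
From mathcomp Require Import all_classical all_reals all_analysis.
From mathcomp Require Import ring lra.

Set Implicit Arguments.
Unset Strict Implicit.
Unset Printing Implicit Defensive.

Import Order.TTheory GRing.Theory Num.Theory.

Local Open Scope classical_set_scope.
Local Open Scope ring_scope.

(* The norm that the analysis library puts on 'rV[R]_d is the sup norm. *)
Definition enorm (R : realType) (d : nat) (x : 'rV[R]_d) : R :=
  Num.sqrt (\sum_(j < d) x 0 j ^+ 2).

Definition log2 (R : realType) (x : R) : R := ln x / ln 2.

(* Only meaningful on nonempty sequences. *)
Definition seqmin (R : realType) (s : seq R) : R :=
  \big[Num.min/head 0 s]_(x <- s) x.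

(* The partition is S_i = {t | a t = i}; the S_i are sets of positions of the
   stream, so repeated vectors count with multiplicity. *)
Definition kmeans_cost (R : realType) (d k n : nat) (v : n.-tuple 'rV[R]_d)
    (a : {ffun 'I_n -> 'I_k}) (c : 'I_k -> 'rV[R]_d) : R :=
  \sum_(i < k) \sum_(t < n | a t == i) enorm (tnth v t - c i) ^+ 2.

(* The infimum is a minimum: see kmeans_opt_attained. *)
Definition kmeans_opt (R : realType) (d k n : nat) (v : n.-tuple 'rV[R]_d) : R :=
  inf [set w | exists a : {ffun 'I_n -> 'I_k},
               exists c : 'I_k -> 'rV[R]_d, w = kmeans_cost v a c].

Definition dist_to (R : realType) (d : nat) (v : 'rV[R]_d) (C : seq 'rV[R]_d) : R :=
  seqmin [seq enorm (v - c) | c <- C].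

(* Ties are broken in favour of the center that was opened first. *)
Definition nearest (R : realType) (d : nat) (v : 'rV[R]_d) (C : seq 'rV[R]_d) :
    'rV[R]_d :=
  head 0 [seq c <- C |
            all (fun c' => enorm (v - c) ^+ 2 <= enorm (v - c') ^+ 2) C].

(* Finitely supported distributions, as lists of (probability, value) pairs. *)
Definition dist (R : realType) (A : Type) : Type := seq (R * A).

Definition dret (R : realType) (A : Type) (x : A) : dist R A := [:: (1, x)].

Definition dbind (R : realType) (A B : Type) (mu : dist R A) (g : A -> dist R B) :
    dist R B :=
  [seq (w.1 * u.1, u.2) | w <- mu, u <- g w.2].

Definition dflip (R : realType) (p : R) : dist R bool :=
  [:: (p, true); (1 - p, false)].

Definition expect (R : realType) (A : Type) (mu : dist R A) (F : A -> R) : R :=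
  \sum_(w <- mu) w.1 * F w.2.

(* Current C, m, f_r and q_r; the value of r itself is never consulted. *)
Record state (R : realType) (d : nat) : Type := State {
  centers : seq 'rV[R]_d;
  seen : nat;
  facility : R;
  opened : nat }.

(* split_stream j [::] s = (the first j distinct vectors of s, the remaining
   vectors of s in order); C holds the distinct vectors found so far. *)
Fixpoint split_stream (R : realType) (d : nat) (j : nat) (C s : seq 'rV[R]_d) :
    seq 'rV[R]_d * seq 'rV[R]_d :=
  if s is v :: s' then
    if (size C < j)%N && (v \notin C) then split_stream j (rcons C v) s'
    else let: (C', rest) := split_stream j C s' in (C', v :: rest)
  else (C, [::]).

Definition wstar0 (R : realType) (d : nat) (C : seq 'rV[R]_d) : R :=
  seqmin [seq enorm (p.1 - p.2) ^+ 2 / 2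
         | p <- [seq (x, y) | x <- C, y <- C] & p.1 != p.2].

Definition init_state (R : realType) (d k : nat) (C : seq 'rV[R]_d) : state R d :=
  State C k.+1 (wstar0 C / k%:R) 0.

Definition open_prob (R : realType) (d : nat) (st : state R d) (v : 'rV[R]_d) : R :=
  Num.min (dist_to v (centers st) ^+ 2 / facility st) 1.

Definition step (R : realType) (d k : nat) (st : state R d) (v : 'rV[R]_d)
    (b : bool) : state R d :=
  let m := (seen st).+1 in
  let C := if b then rcons (centers st) v else centers st in
  let q := (opened st + b)%N in
  if 3 * k%:R * (1 + log2 m%:R) <= q%:R :> R
  then State C m (2 * facility st) 0
  else State C m (facility st) q.

(* The law of the list of pairs (vector, center it is assigned to). *)
Fixpoint process (R : realType) (d k : nat) (st : state R d) (s : seq 'rV[R]_d) :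
    dist R (seq ('rV[R]_d * 'rV[R]_d)) :=
  if s is v :: s' then
    dbind (dflip (open_prob st v)) (fun b =>
      let st' := step k st v b in
      dbind (process k st' s') (fun out =>
        dret R ((v, nearest v (centers st')) :: out)))
  else dret R [::].

Definition online_kmeans (R : realType) (d k : nat) (s : seq 'rV[R]_d) :
    dist R (seq ('rV[R]_d * 'rV[R]_d)) :=
  let: (C, rest) := split_stream k.+1 [::] s in
  dbind (process k (init_state k C) rest) (fun out =>
    dret R ([seq (c, c) | c <- C] ++ out)).

Definition assignment_cost (R : realType) (d : nat)
    (out : seq ('rV[R]_d * 'rV[R]_d)) : R :=
  \sum_(vc <- out) enorm (vc.1 - vc.2) ^+ 2.

Lemma sqr_enorm (R : realType) (d : nat) (x : 'rV[R]_d) :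
  enorm x ^+ 2 = \sum_(j < d) x 0 j ^+ 2.
Proof. by rewrite sqr_sqrtr// sumr_ge0// => j _; exact: sqr_ge0. Qed.

Lemma centroid_min (R : realType) (d n : nat) (P : pred 'I_n)
    (x : 'I_n -> 'rV[R]_d) :
  exists mu : 'rV[R]_d, forall c,
  \sum_(t | P t) enorm (x t - mu) ^+ 2 <= \sum_(t | P t) enorm (x t - c) ^+ 2.
Proof.
pose N : R := \sum_(t | P t) 1.
have sumP (e : R) : \sum_(t | P t) e = N * e.
  by rewrite /N mulr_suml; apply: eq_bigr => t _; rewrite mul1r.
case: (pickP P) => [t0 Pt0|P0]; last by exists 0 => c; rewrite !big_pred0.
have N1 : 0 < N by rewrite /N (bigD1 t0)//= ltr_pwDl// sumr_ge0.
exists (N^-1 *: \sum_(t | P t) x t) => c.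
under eq_bigr do rewrite sqr_enorm.
under [leRHS]eq_bigr do rewrite sqr_enorm.
rewrite exchange_big [leRHS]exchange_big/=; apply: ler_sum => j _.
under eq_bigr do rewrite !mxE summxE.
under [leRHS]eq_bigr do rewrite !mxE.
set S := \sum_(t | P t) x t 0 j.
have E (e : R) : \sum_(t | P t) (x t 0 j - e) ^+ 2 =
    \sum_(t | P t) x t 0 j ^+ 2 - 2 * e * S + N * e ^+ 2.
  rewrite -(sumP (e ^+ 2)) /S mulr_sumr -sumrB -big_split/=.
  by apply: eq_bigr => t _; ring.
rewrite !E -subr_ge0.
have -> : \sum_(t | P t) x t 0 j ^+ 2 - 2 * c 0 j * S + N * c 0 j ^+ 2 -
    (\sum_(t | P t) x t 0 j ^+ 2 - 2 * (N^-1 * S) * S + N * (N^-1 * S) ^+ 2) =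
    N * (c 0 j - N^-1 * S) ^+ 2 by field; rewrite gt_eqF.
by rewrite mulr_ge0 ?sqr_ge0 ?ltW.
Qed.

Lemma kmeans_opt_attained (R : realType) (d k n : nat) (v : n.-tuple 'rV[R]_d) :
  (0 < k)%N ->
  exists (a : {ffun 'I_n -> 'I_k}) c, kmeans_opt k v = kmeans_cost v a c /\
    forall (a' : {ffun 'I_n -> 'I_k}) c', kmeans_cost v a c <= kmeans_cost v a' c'.
Proof.
move=> k0.
have /choice[mu muP] (a : {ffun 'I_n -> 'I_k}) : exists m : 'I_k -> 'rV[R]_d,
    forall c, kmeans_cost v a m <= kmeans_cost v a c.
  have /choice[m mP] i := centroid_min (fun t => a t == i) (tnth v).
  by exists m => c; apply: ler_sum => i _; exact: mP.
pose a := [arg min_(a < [ffun _ => Ordinal k0] : {ffun 'I_n -> 'I_k})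
             kmeans_cost v a (mu a)]%O.
have aP (a' : {ffun 'I_n -> 'I_k}) c' :
    kmeans_cost v a (mu a) <= kmeans_cost v a' c'.
  apply: le_trans (muP a' c'); rewrite /a.
  by case: arg_minP => //= b _; exact.
exists a, (mu a); split=> //; apply/eqP; rewrite eq_le; apply/andP; split.
  apply: ge_inf; last by exists a, (mu a).
  by exists (kmeans_cost v a (mu a)) => _ [a' [c' ->]].
apply: lb_le_inf; first by exists (kmeans_cost v a (mu a)), a, (mu a).
by move=> _ [a' [c' ->]].
Qed.

Lemma perm_split_stream (R : realType) (d j : nat) (C s : seq 'rV[R]_d) :
  perm_eq ((split_stream j C s).1 ++ (split_stream j C s).2) (C ++ s).
Proof.
elim: s C => [|v s IH] C //=.
case: ifP => _; first by rewrite (permPl (IH _)) cat_rcons.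
have := IH C; case: (split_stream j C s) => C' r /= H.
by rewrite -(cat1s v r) -(cat1s v s) perm_catCA [perm_eq _ (C ++ _)]perm_sym
           perm_catCA perm_cat2l perm_sym.
Qed.

Lemma expect_dret (R : realType) (A : Type) (x : A) (F : A -> R) :
  expect (dret R x) F = F x.
Proof. by rewrite /expect big_seq1 mul1r. Qed.

Lemma expect_dbind (R : realType) (A B : Type) (mu : dist R A)
    (g : A -> dist R B) (F : B -> R) :
  expect (dbind mu g) F = expect mu (fun x => expect (g x) F).
Proof.
rewrite /expect /dbind big_allpairs_dep/=; apply: eq_bigr => w _.
by rewrite mulr_sumr; apply: eq_bigr => u _; rewrite mulrA.
Qed.

Lemma expect_dflip (R : realType) (p : R) (F : bool -> R) :
  expect (dflip p) F = p * F true + (1 - p) * F false.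
Proof. by rewrite /expect big_cons big_seq1. Qed.

Lemma expect_online_kmeans1 (R : realType) (d k : nat) (s : seq 'rV[R]_d) :
  expect (online_kmeans k s) (fun=> 1) = 1.
Proof.
have D A B (mu : dist R A) (h : A -> B) :
    expect (dbind mu (fun x => dret R (h x))) (fun=> 1) = expect mu (fun=> 1).
  by rewrite expect_dbind; apply: eq_bigr => w _; rewrite expect_dret.
have H st r : expect (@process R d k st r) (fun=> 1) = 1.
  elim: r st => [|v r IH] st /=; first by rewrite expect_dret.
  by rewrite expect_dbind expect_dflip /= !D !IH; ring.
rewrite /online_kmeans; case: split_stream => C r.
by rewrite D.
Qed.

Lemma seqmin_ge0 (R : realType) (s : seq R) :
  all (fun x => 0 <= x) s -> 0 <= seqmin s.
Proof.
move=> s0; rewrite /seqmin.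
have : 0 <= head 0 s by case: s s0 => //= x s /andP[].
elim: s (head 0 s) s0 => [|x s IH] h /=; first by rewrite big_nil.
by move=> /andP[x0 s0] h0; rewrite big_cons le_min x0 IH.
Qed.

Lemma expect_online_kmeans_ge0 (R : realType) (d k : nat) (s : seq 'rV[R]_d)
    (F : seq ('rV[R]_d * 'rV[R]_d) -> R) :
  (forall out, 0 <= F out) -> 0 <= expect (online_kmeans k s) F.
Proof.
have H st r G : 0 <= facility st -> (forall out, 0 <= G out) ->
    0 <= expect (@process R d k st r) G.
  elim: r st G => [|v r IH] st G f0 G0 /=; first by rewrite expect_dret.
  rewrite expect_dbind expect_dflip !expect_dbind.
  have fS b : 0 <= facility (step k st v b).
    by rewrite /step; case: ifP => //= _; rewrite mulr_ge0.
  have p0 : 0 <= open_prob st v by rewrite le_min ler01 divr_ge0 ?sqr_ge0.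
  have p1 : 0 <= 1 - open_prob st v by rewrite subr_ge0 ge_min lexx orbT.
  by apply: addr_ge0; apply: mulr_ge0 => //; apply: IH => // out;
     rewrite expect_dret.
move=> F0; rewrite /online_kmeans; case: split_stream => C r.
rewrite expect_dbind; apply: H => [|out]; last by rewrite expect_dret.
rewrite divr_ge0// seqmin_ge0//; apply/allP => _ /mapP[p _ ->].
by rewrite divr_ge0 ?sqr_ge0.
Qed.

(* Main.v *)
Require Import Defs.
From mathcomp Require Import all_boot all_order all_algebra.
From mathcomp Require Import all_classical all_reals all_analysis.
From mathcomp Require Import ring lra zify.

Set Implicit Arguments.
Unset Strict Implicit.
Unset Printing Implicit Defensive.

Import Order.TTheory GRing.Theory Num.Theory.

Local Open Scope ring_scope.

(** Fix optimal centers [c_i] and let [W] be the optimal cost.  A step with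
    facility cost [f] costs in expectation at most [f] times the probability of
    opening, and a phase opens at most [T = 3 k (1 + log n) + 1] centers.  When
    [v], the [m]-th vector, is opened, either
    [D^2(v, C) <= 9 |v - c_i|^2 + 4 W / m^2], and the opening is charged, or [v]
    is at least twice as close to [c_i] as [C] was; the latter happens at most
    [2 + log m] times per cluster and phase.  Hence a phase ends only after [k]
    charged openings, while the expected sum of [f] over all charged openings,
    in all phases, is at most [13 W].  Weighting charged openings by [2 T / k]
    yields the potential
      [f (T - q) + (2 T / k) (f z + 9 sum |v - c_i|^2 + 4 W / m)]
    ([z] charged openings in the phase, sum over the vectors to come), which
    bounds the expected future cost even across phase changes; initially it is
    [O (T W / k)]. *)

Section SeqMin.
Variable R : realType.
Implicit Types (s : seq R) (x : R).

Lemma seqmin_le s x : x \in s -> seqmin s <= x.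
Proof. by move=> xs; exact: ge_bigmin_seq. Qed.

Lemma seqmin_mem s : s != [::] -> seqmin s \in s.
Proof.
case: s => // x s _; rewrite /seqmin big_seq.
elim/big_ind: _ => [|y z ys zs|//]; first exact: mem_head.
by rewrite minEle; case: ifP.
Qed.

End SeqMin.

Section PointDistances.
Variables (R : realType) (d : nat).
Implicit Types (x y z v c : 'rV[R]_d) (C : seq 'rV[R]_d).

Lemma enorm_ge0 x : 0 <= enorm x.
Proof. exact: sqrtr_ge0. Qed.

Lemma enorm_eq0 x : (enorm x == 0) = (x == 0).
Proof.
rewrite -sqrf_eq0 sqr_enorm psumr_eq0; last by move=> j _; exact: sqr_ge0.
apply/allP/eqP => [x0|-> j _]; last by rewrite mxE expr0n eqxx.
apply/rowP => j; rewrite mxE; apply/eqP; rewrite -sqrf_eq0.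
exact: x0 (mem_index_enum j).
Qed.

Lemma enorm0 : enorm (0 : 'rV[R]_d) = 0.
Proof. by apply/eqP; rewrite enorm_eq0. Qed.

Lemma sqr_enormB_le (t : R) x y z : 0 < t ->
  enorm (x - y) ^+ 2 <=
    (1 + t) * enorm (x - z) ^+ 2 + (1 + t^-1) * enorm (y - z) ^+ 2.
Proof.
move=> t0; rewrite !sqr_enorm !mulr_sumr -big_split/=.
apply: ler_sum => j _; rewrite !mxE -subr_ge0.
rewrite (_ : _ - _ = t * ((x 0 j - z 0 j) + (y 0 j - z 0 j) / t) ^+ 2).
  by rewrite mulr_ge0 ?sqr_ge0 ?ltW.
by field; rewrite gt_eqF.
Qed.

Lemma dist_to_ge0 v C : 0 <= dist_to v C.
Proof. by apply/seqmin_ge0/allP => _ /mapP[c _ ->]; exact: enorm_ge0. Qed.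

Lemma dist_to_le v c C : c \in C -> dist_to v C <= enorm (v - c).
Proof. by move=> cC; apply/seqmin_le/(map_f (fun x => enorm (v - x))). Qed.

Lemma dist_to_attained v C :
  C != [::] -> exists2 c, c \in C & dist_to v C = enorm (v - c).
Proof.
move=> C0; have : [seq enorm (v - c) | c <- C] != [::] by case: C C0.
by move=> /seqmin_mem/mapP[c cC e]; exists c.
Qed.

Lemma dist_to_mem v C : v \in C -> dist_to v C = 0.
Proof.
move=> /(dist_to_le v); rewrite subrr enorm0 => le0.
by apply/le_anti; rewrite le0 dist_to_ge0.
Qed.

Lemma enorm_nearest v C : C != [::] -> enorm (v - nearest v C) = dist_to v C.
Proof.
move=> /(dist_to_attained v)[x xC xD]; rewrite /nearest.
set closest := [seq c <- C | _].
have headP : x \in closest -> head 0 closest \in closest.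
  by case: (closest) => // y s _; exact: mem_head.
have /headP : x \in closest.
  rewrite mem_filter xC andbT; apply/allP => y yC.
  by rewrite ler_sqr ?nnegrE ?enorm_ge0// -xD dist_to_le.
rewrite mem_filter => /andP[/allP/(_ _ xC) le_x in_C].
apply/le_anti; rewrite dist_to_le// andbT xD.
by rewrite -ler_sqr ?nnegrE ?enorm_ge0.
Qed.

Lemma far_from_centers v x C (w : R) : 0 <= w ->
  9 * enorm (v - x) ^+ 2 + 4 * w < dist_to v C ^+ 2 ->
  {in C, forall y, 4 * enorm (v - x) ^+ 2 <= enorm (y - x) ^+ 2 /\
                   w <= enorm (y - x) ^+ 2}.
Proof.
move=> w0 far y yC.
have via_x : dist_to v C ^+ 2 <=
    3 * enorm (v - x) ^+ 2 + 3 / 2 * enorm (y - x) ^+ 2.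
  have : dist_to v C ^+ 2 <= enorm (v - y) ^+ 2.
    by rewrite ler_sqr ?nnegrE ?dist_to_ge0 ?enorm_ge0 ?dist_to_le.
  by have := @sqr_enormB_le 2 v y x (ltr0Sn _ _); lra.
by have := sqr_ge0 (enorm (v - x)); split; lra.
Qed.

End PointDistances.

Section Log2.
Variable R : realType.
Implicit Types x y : R.

Let ln2_gt0 : 0 < ln 2 :> R.
Proof. by rewrite ln_gt0 ?ltr1n. Qed.

Lemma ler_log2 x y : 0 < x -> x <= y -> log2 x <= log2 y.
Proof.
move=> x0 xy; rewrite ler_pM2r ?invr_gt0// ler_ln ?posrE//.
exact: lt_le_trans xy.
Qed.

Lemma log2X (n : nat) : log2 (2 ^+ n) = n%:R :> R.
Proof. by rewrite /log2 lnXn// -[_ *+ n]mulr_natl mulfK// gt_eqF. Qed.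

Lemma log2M x y : 0 < x -> 0 < y -> log2 (x * y) = log2 x + log2 y.
Proof. by move=> x0 y0; rewrite /log2 lnM ?posrE// mulrDl. Qed.

Lemma log2_ge0 x : 1 <= x -> 0 <= log2 x.
Proof. by move=> x1; rewrite divr_ge0 ?ln_ge0 ?ler1n. Qed.

End Log2.

Section Expectation.
Variables (R : realType) (A B : Type).

Lemma expect_map (mu : dist R A) (h : A -> B) (F : B -> R) :
  expect (dbind mu (fun x => dret R (h x))) F = expect mu (F \o h).
Proof. by rewrite expect_dbind; apply: eq_bigr => w _; rewrite expect_dret. Qed.

Lemma expect_addl (mu : dist R A) (a : R) (F : A -> R) :
  expect mu (fun x => a + F x) = a * expect mu (fun=> 1) + expect mu F.
Proof.
rewrite /expect mulr_sumr -big_split/=; apply: eq_bigr => w _.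
by rewrite mulrDr mulr1 mulrC.
Qed.

End Expectation.

Section ExpectedCost.
Variables (R : realType) (d k : nat).
Implicit Types (st : state R d) (v : 'rV[R]_d) (s : seq 'rV[R]_d) (b : bool).

Definition opening_quota (m : nat) : R := 3 * k%:R * (1 + log2 m%:R).

Definition phase_ends st b : bool :=
  opening_quota (seen st).+1 <= (opened st + b)%:R.

Lemma stepE st v b :
  step k st v b =
    State (if b then rcons (centers st) v else centers st) (seen st).+1
          (if phase_ends st b then 2 * facility st else facility st)
          (if phase_ends st b then 0 else opened st + b)%N.
Proof. by rewrite /step -/(opening_quota _) -/(phase_ends st b); case: ifP. Qed.

Lemma open_prob_ge0 st v : 0 < facility st -> 0 <= open_prob st v.
Proof. by move=> f0; rewrite le_min ler01 divr_ge0 ?sqr_ge0// ltW. Qed.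

Lemma open_prob_le1 st v : open_prob st v <= 1.
Proof. by rewrite ge_min lexx orbT. Qed.

Lemma open_prob_facility_le st v :
  0 < facility st ->
  open_prob st v * facility st <= dist_to v (centers st) ^+ 2.
Proof. by move=> f0; rewrite -ler_pdivlMr// ge_min lexx. Qed.

(* The opening probability is either [1] or exactly [D^2 / f]. *)
Lemma unopened_cost_le st v : 0 < facility st ->
  (1 - open_prob st v) * dist_to v (centers st) ^+ 2 <=
    open_prob st v * facility st.
Proof.
move=> f0; have p0 := open_prob_ge0 v f0; move: p0; rewrite /open_prob minEle.
case: ifP => _ p0; last by rewrite subrr mul0r mul1r ltW.
by rewrite divfK ?gt_eqF// ler_piMl ?sqr_ge0// gerBl.
Qed.

Lemma expect_process1 st s : expect (process k st s) (fun=> 1) = 1.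
Proof.
elim: s st => [|v s IH] st /=; first by rewrite expect_dret.
by rewrite expect_dbind expect_dflip !expect_map !IH !mulr1 addrC subrK.
Qed.

Definition expected_cost st s : R :=
  expect (process k st s) (@assignment_cost R d).

Lemma expected_cost_nil st : expected_cost st [::] = 0.
Proof. by rewrite /expected_cost /= expect_dret /assignment_cost big_nil. Qed.

Lemma expected_cost_cons st v s (p := open_prob st v)
    (V := fun b => enorm (v - nearest v (centers (step k st v b))) ^+ 2 +
                   expected_cost (step k st v b) s) :
  expected_cost st (v :: s) = p * V true + (1 - p) * V false.
Proof.
rewrite /expected_cost /= expect_dbind expect_dflip !expect_map.
have costE x : @assignment_cost R d \o cons (v, x) =
    fun out => enorm (v - x) ^+ 2 + assignment_cost out.
  by apply/funext => out; rewrite /= /assignment_cost big_cons.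
by rewrite !costE !expect_addl !expect_process1 !mulr1.
Qed.

Lemma expected_cost_cons_le st v s (p := open_prob st v)
    (V := fun b => expected_cost (step k st v b) s) :
  0 < facility st -> centers st != [::] ->
  expected_cost st (v :: s) <= p * (facility st + V true) + (1 - p) * V false.
Proof.
move=> f0 C0; rewrite expected_cost_cons -/p -/(V true) -/(V false) !stepE/=.
rewrite !enorm_nearest//; last by case: (centers st).
rewrite dist_to_mem ?mem_rcons ?mem_head//.
have := unopened_cost_le v f0; rewrite -/p; lra.
Qed.

End ExpectedCost.

Lemma exp4_le_sqr (R : realDomainType) (u m : nat) :
  (4 ^+ u <= 4 * m%:R ^+ 2 :> R) = (2 ^ u <= 2 * m)%N.
Proof.
by rewrite -!natrX -natrM ler_nat -[4%N]/(2 ^ 2)%N -expnAC -expnMn leq_sqr.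
Qed.

Section Halvings.
Variables (R : realType) (d : nat) (W : R).
Implicit Types (C : seq 'rV[R]_d) (v x : 'rV[R]_d) (m u : nat).

Definition allowance m v x : R := 9 * enorm (v - x) ^+ 2 + 4 * (W / m%:R ^+ 2).

Lemma allowance_ge0 m v x : 0 <= W -> 0 <= allowance m v x.
Proof. by move=> W0; rewrite addr_ge0// mulr_ge0 ?divr_ge0 ?sqr_ge0. Qed.

(* [u] openings beyond the allowance: each at least halves the distance from
   [x] to [C], and none is possible once that distance is below [sqrt W / m]. *)
Definition halvings C m x u : Prop :=
  (2 ^ u <= 4 * m)%N /\
  (u = 0%N \/ exists2 y, y \in C & 4 ^+ u * enorm (y - x) ^+ 2 <= 4 * W).

Lemma halvings0 C m x : (0 < m)%N -> halvings C m x 0.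
Proof. by move=> m0; split; [lia|left]. Qed.

Lemma halvings_sub C C' m m' x u :
  {subset C <= C'} -> (m <= m')%N -> halvings C m x u -> halvings C' m' x u.
Proof.
move=> CC' mm' [um uC]; split; first by rewrite (leq_trans um)// leq_mul.
by case: uC => [->|[y /CC' yC yx]]; [left|right; exists y].
Qed.

Lemma halvings_rcons C m v x u : (0 < m)%N -> 0 < W ->
  enorm (v - x) ^+ 2 <= W -> allowance m v x < dist_to v C ^+ 2 ->
  halvings C m x u -> halvings (rcons C v) m x u.+1.
Proof.
move=> m0 W0 vx far [_ uC]; have M0 : 0 < m%:R :> R by rewrite ltr0n.
have w0 : 0 < W / m%:R ^+ 2 by rewrite divr_gt0 ?exprn_gt0.
have closer := far_from_centers (ltW w0) far.
split.
  case: uC => [->|[y /closer[_ wy] uy]]; first lia.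
  suff : (2 ^ u <= 2 * m)%N by rewrite expnS; lia.
  have : 4 ^+ u * (W / m%:R ^+ 2) <= 4 * W.
    by apply: le_trans uy; rewrite ler_pM2l ?exprn_gt0.
  by rewrite mulrCA mulrC ler_pM2r// ler_pdivrMr ?exprn_gt0// exp4_le_sqr.
right; exists v; first by rewrite mem_rcons mem_head.
rewrite exprSr -mulrA.
case: uC => [->|[y /closer[vy _] uy]]; first by rewrite expr0 mul1r ler_pM2l.
by apply: le_trans uy; rewrite ler_pM2l ?exprn_gt0.
Qed.

Lemma halvings_le_log2 C m x u :
  (0 < m)%N -> halvings C m x u -> u%:R <= 2 + log2 m%:R :> R.
Proof.
move=> m0 [um _]; rewrite -(log2X R 2) -log2M ?ltr0n// -log2X ler_log2//.
by rewrite -!natrX -natrM ler_nat.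
Qed.

End Halvings.

Section Ledger.
Variables (R : realType) (d k : nat) (c : 'I_k -> 'rV[R]_d) (W : R).
Implicit Types (C : seq 'rV[R]_d) (v : 'rV[R]_d) (m q z : nat).

(* Of the [q] openings of a phase, [z] are charged; [u i] bounds the number of
   the others that fall in the cluster of [c i]. *)
Definition ledger C m q z : Prop :=
  exists2 u : 'I_k -> nat, (q <= z + \sum_i u i)%N &
    forall i, halvings W C m (c i) (u i).

Lemma ledger0 C m : (0 < m)%N -> ledger C m 0 0.
Proof. by move=> m0; exists (fun=> 0%N) => // i; exact: halvings0. Qed.

Lemma ledger_sub C C' m m' q z :
  {subset C <= C'} -> (m <= m')%N -> ledger C m q z -> ledger C' m' q z.
Proof.
by move=> CC' mm' [u qu uC]; exists u => // i; exact: halvings_sub (uC i).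
Qed.

Lemma ledger_charge C m q z : ledger C m q z -> ledger C m q.+1 z.+1.
Proof. by move=> [u qu uC]; exists u. Qed.

Lemma ledger_halve C m q z v i : (0 < m)%N -> 0 < W ->
  enorm (v - c i) ^+ 2 <= W -> allowance W m v (c i) < dist_to v C ^+ 2 ->
  ledger C m q z -> ledger (rcons C v) m q.+1 z.
Proof.
move=> m0 W0 vc far [u qu uC].
exists (fun j => u j + (j == i))%N => [|j].
  have -> : (\sum_j (u j + (j == i)) = (\sum_j u j).+1)%N.
    rewrite big_split/= -addn1; congr addn.
    by rewrite (bigD1 i)//= eqxx big1 // => j /negPf->.
  by rewrite addnS ltnS.
have [->|_] := eqVneq j i; first by rewrite addn1; exact: halvings_rcons.
rewrite addn0; apply: halvings_sub (uC j) => //.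
exact/mem_subseq/subseq_rcons.
Qed.

Lemma ledger_quota_le C m q z :
  (0 < m)%N -> ledger C m q z -> opening_quota R k m <= q%:R -> (k <= z)%N.
Proof.
move=> m0 [u qu uC] quota; rewrite -(ler_nat R).
have : (\sum_i u i)%:R <= k%:R * (2 + log2 m%:R) :> R.
  rewrite natr_sum mulr_natl -[X in _ *+ X]card_ord -sumr_const.
  by apply: ler_sum => i _; exact: halvings_le_log2 (uC i).
have : q%:R <= z%:R + (\sum_i u i)%:R :> R by rewrite -natrD ler_nat.
have : 0 <= k%:R * log2 m%:R :> R by rewrite mulr_ge0 ?log2_ge0 ?ler1n.
by move: quota; rewrite /opening_quota; lra.
Qed.

End Ledger.

Lemma invr_sqr_telescope (R : realFieldType) (x : R) :
  0 < x -> ((x + 1) ^+ 2)^-1 + (x + 1)^-1 <= x^-1.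
Proof.
move=> x0; rewrite -subr_ge0.
rewrite (_ : _ - _ = (x * (x + 1) ^+ 2)^-1); last by field; lra.
by rewrite invr_ge0 mulr_ge0 ?exprn_ge0//; lra.
Qed.

Section ClusteringCost.
Variables (R : realType) (d k : nat).
Variables (c : 'I_k -> 'rV[R]_d) (g : 'rV[R]_d -> 'I_k).
Implicit Types (v : 'rV[R]_d) (s : seq 'rV[R]_d).

Definition clustering_cost s : R := \sum_(v <- s) enorm (v - c (g v)) ^+ 2.

Lemma clustering_cost_ge0 s : 0 <= clustering_cost s.
Proof. by apply: sumr_ge0 => v _; exact: sqr_ge0. Qed.

Lemma clustering_cost_cons v s :
  clustering_cost (v :: s) = enorm (v - c (g v)) ^+ 2 + clustering_cost s.
Proof. exact: big_cons. Qed.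

Lemma clustering_cost_cat s1 s2 :
  clustering_cost (s1 ++ s2) = clustering_cost s1 + clustering_cost s2.
Proof. exact: big_cat. Qed.

Lemma perm_clustering_cost s1 s2 :
  perm_eq s1 s2 -> clustering_cost s1 = clustering_cost s2.
Proof. exact: perm_big. Qed.

Lemma clustering_cost_rem v s : v \in s ->
  clustering_cost s = enorm (v - c (g v)) ^+ 2 + clustering_cost (rem v s).
Proof.
by move=> /perm_to_rem/perm_clustering_cost->; rewrite clustering_cost_cons.
Qed.

End ClusteringCost.

Section Amortization.
Variables (R : realType) (d k n : nat).
Variables (c : 'I_k -> 'rV[R]_d) (g : 'rV[R]_d -> 'I_k) (W : R).
Hypotheses (k_gt0 : (0 < k)%N) (W_gt0 : 0 < W).
Implicit Types (st : state R d) (v : 'rV[R]_d) (s : seq 'rV[R]_d).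
Implicit Types (b : bool) (m z : nat).

(* The opening that ends a phase overshoots the quota by at most one. *)
Definition phase_capacity : R := opening_quota R k n + 1.

Record run_invariant st s z : Prop := RunInvariant {
  run_facility_gt0 : 0 < facility st;
  run_centers_neq0 : centers st != [::];
  run_seen_gt0 : (0 < seen st)%N;
  run_length : (seen st + size s <= n)%N;
  run_opened_le : (opened st)%:R <= opening_quota R k n;
  run_deviation_le : {in s, forall v, enorm (v - c (g v)) ^+ 2 <= W};
  run_ledger : ledger c W (centers st) (seen st) (opened st) z }.

Definition charged st v : bool :=
  dist_to v (centers st) ^+ 2 <= allowance W (seen st).+1 v (c (g v)).

Definition charged_after st v b z : nat :=
  if phase_ends k st b then 0%N else (z + (b && charged st v))%N.

Definition reserve m s : R := 9 * clustering_cost c g s + 4 * (W / m%:R).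

Definition potential st s z : R :=
  facility st * (phase_capacity - (opened st)%:R) +
  2 * phase_capacity / k%:R * (facility st * z%:R + reserve (seen st) s).

Let K_gt0 : 0 < k%:R :> R.
Proof. by rewrite ltr0n. Qed.

Lemma phase_capacity_ge1 st s z : run_invariant st s z -> 1 <= phase_capacity.
Proof. by move=> inv; rewrite lerDr (le_trans _ (run_opened_le inv)). Qed.

Lemma reserve_ge0 m s : 0 <= reserve m s.
Proof.
apply: addr_ge0; apply: mulr_ge0 => //; first exact: clustering_cost_ge0.
by rewrite divr_ge0// ltW.
Qed.

Lemma allowance_reserve_le m v s : (0 < m)%N ->
  allowance W m.+1 v (c (g v)) + reserve m.+1 s <= reserve m (v :: s).
Proof.
move=> m0; rewrite /reserve clustering_cost_cons mulrDr addrACA lerD2l -!mulrDr.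
by rewrite !ler_pM2l// -natr1 invr_sqr_telescope ?ltr0n.
Qed.

Lemma potential_ge0 st s z : run_invariant st s z -> 0 <= potential st s z.
Proof.
move=> inv; have := phase_capacity_ge1 inv.
case: inv => f0 _ _ _ qT _ _ T1.
apply: addr_ge0; apply: mulr_ge0.
- exact: ltW.
- by rewrite subr_ge0 (le_trans qT)// lerDl.
- by rewrite divr_ge0// mulr_ge0//; lra.
- by rewrite addr_ge0 ?reserve_ge0// mulr_ge0// ltW.
Qed.

Lemma ledger_step st v s z b : run_invariant st (v :: s) z ->
  ledger c W (if b then rcons (centers st) v else centers st) (seen st).+1
         (opened st + b) (z + (b && charged st v)).
Proof.
case=> _ _ _ _ _ /(_ v (mem_head v s)) vW led.
have {}led : ledger c W (centers st) (seen st).+1 (opened st) z.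
  exact: ledger_sub led.
case: b => /=; last by rewrite !addn0.
rewrite /charged addn1; case: leP => [_|far]; last first.
  by rewrite addn0; exact: ledger_halve far led.
rewrite addn1; apply/ledger_charge/(ledger_sub _ _ led) => //.
exact/mem_subseq/subseq_rcons.
Qed.

Lemma run_invariant_step st v s z b : run_invariant st (v :: s) z ->
  run_invariant (step k st v b) s (charged_after st v b z).
Proof.
move=> inv; have led := ledger_step b inv.
case: inv => f0 C0 m0 mn qT dev_le _.
have {}mn : ((seen st).+1 + size s <= n)%N by rewrite addSnnS.
rewrite stepE /charged_after; split=> //=.
- by case: ifP => // _; rewrite mulr_gt0.
- by case: b {led} => //; case: (centers st).
- case: ifPn => [_|]; first by rewrite (le_trans _ qT).
  rewrite -ltNge => /ltW/le_trans; apply; rewrite ler_pM2l ?mulr_gt0// lerD2l.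
  by rewrite ler_log2// ler_nat (leq_trans (leq_addr _ _) mn).
- by move=> w ws; apply: dev_le; rewrite inE ws orbT.
- by case: (phase_ends _ _ _) => //; exact: ledger0.
Qed.

(* A phase ends with at least [k] charged openings, whose weight [2 T f] pays
   for the capacity [T] of the next phase at its facility cost [2 f]. *)
Lemma potential_step_le st v s z b : run_invariant st (v :: s) z ->
  potential (step k st v b) s (charged_after st v b z) <=
    facility st * (phase_capacity - (opened st + b)%:R) +
    2 * phase_capacity / k%:R *
      (facility st * (z + (b && charged st v))%:R + reserve (seen st).+1 s).
Proof.
move=> inv; have T1 := phase_capacity_ge1 inv; have led := ledger_step b inv.
rewrite stepE /charged_after /potential/=; case: ifP => // ends.
have [f0 _ _ _ qT _ _] := inv.
have := ledger_quota_le (ltn0Sn _) led ends; set z' := addn z _ => kz.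
rewrite mulr0 add0r subr0 [X in _ <= _ + X]mulrDr addrA lerD2r.
have opened_le : (opened st + b)%:R <= phase_capacity.
  by rewrite natrD lerD// lern1 leq_b1.
have : 0 <= facility st * (phase_capacity - (opened st + b)%:R).
  by rewrite mulr_ge0 ?subr_ge0// ltW.
suff : 2 * facility st * phase_capacity <=
    2 * phase_capacity / k%:R * (facility st * z'%:R) by lra.
rewrite (_ : _ / _ * _ = 2 * facility st * phase_capacity * (z'%:R / k%:R)).
  rewrite ler_peMr ?ler_pdivlMr ?mul1r ?ler_nat// !mulr_ge0 ?ltW//; lra.
by field; rewrite gt_eqF.
Qed.

Lemma charged_facility_le st v : 0 < facility st ->
  open_prob st v * facility st * (charged st v)%:R <=
    allowance W (seen st).+1 v (c (g v)).
Proof.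
move=> f0; rewrite /charged; case: (leP (dist_to _ _ ^+ 2)) => [D_le|_].
  by rewrite mulr1 (le_trans (open_prob_facility_le v f0)).
by rewrite mulr0 allowance_ge0// ltW.
Qed.

Lemma expected_potential_le st v s z (p := open_prob st v)
    (Phi := fun b => potential (step k st v b) s (charged_after st v b z)) :
  run_invariant st (v :: s) z ->
  p * (facility st + Phi true) + (1 - p) * Phi false <= potential st (v :: s) z.
Proof.
move=> inv; have [f0 _ m0 _ _ _ _] := inv.
have p0 : 0 <= p by exact: open_prob_ge0.
have p1 : 0 <= 1 - p by rewrite subr_ge0 open_prob_le1.
have := ler_wpM2l p0 (potential_step_le true inv).
have := ler_wpM2l p1 (potential_step_le false inv).
rewrite -/(Phi true) -/(Phi false) /= !addn0 !natrD /potential.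
set Q := 2 * _ / _; set E := reserve _ s.
have Q0 : 0 <= Q.
  by rewrite divr_ge0// mulr_ge0// (le_trans ler01) ?(phase_capacity_ge1 inv).
have : Q * (p * facility st * (charged st v)%:R + E) <=
    Q * reserve (seen st) (v :: s).
  apply: ler_wpM2l => //; apply: le_trans (allowance_reserve_le v s m0).
  by rewrite lerD2r charged_facility_le.
lra.
Qed.

Lemma expected_cost_le_potential st s z :
  run_invariant st s z -> expected_cost k st s <= potential st s z.
Proof.
elim: s st z => [|v s IH] st z inv.
  by rewrite expected_cost_nil potential_ge0.
have [f0 C0 _ _ _ _ _] := inv.
apply: le_trans (expected_cost_cons_le k v s f0 C0) _.
apply: le_trans (expected_potential_le inv).
have IHb b := IH _ _ (run_invariant_step b inv).
by rewrite lerD// ler_wpM2l ?lerD2l ?open_prob_ge0 ?subr_ge0 ?open_prob_le1.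
Qed.

End Amortization.

Section FirstCenters.
Variables (R : realType) (d : nat).
Implicit Types (C s : seq 'rV[R]_d).

Lemma split_stream_uniq j C s : uniq C -> uniq (split_stream j C s).1.
Proof.
elim: s C => [|v s IH] C uC //=.
case: ifPn => [/andP[_ vC]|_]; first by rewrite IH// rcons_uniq vC.
by have := IH C uC; case: split_stream.
Qed.

Lemma size_split_stream j C s : uniq C -> (size C <= j)%N ->
  size (split_stream j C s).1 = minn j (size (undup (C ++ s))).
Proof.
elim: s C => [|v s IH] C uC Cj /=.
  by rewrite cats0 undup_id// (minn_idPr Cj).
case: ifPn => [/andP[Cj' vC]|old].
  by rewrite IH ?rcons_uniq ?vC ?size_rcons// cat_rcons.
have := IH C uC Cj; case: split_stream => C' rest /= ->.
have [vC|vC] := boolP (v \in C).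
  congr minn; apply/perm_size/perm_undup => x.
  by rewrite !mem_cat inE; case: eqP => // ->; rewrite vC.
have jC : (j <= size C)%N by move: old; rewrite vC andbT -leqNgt.
have full r : minn j (size (undup (C ++ r))) = j.
  apply/minn_idPl/(leq_trans jC)/(uniq_leq_size uC) => x xC.
  by rewrite mem_undup mem_cat xC.
by rewrite !full.
Qed.

Lemma expect_online_kmeansE k s (first := split_stream k.+1 [::] s) :
  expect (online_kmeans k s) (@assignment_cost R d) =
    expected_cost k (init_state k first.1) first.2.
Proof.
rewrite /online_kmeans /first; case: split_stream => C rest /=.
rewrite expect_map; congr expect; apply/funext => out /=.
rewrite /assignment_cost big_cat big_map/= big1 ?add0r// => x _.
by rewrite subrr enorm0 expr0n.
Qed.

Lemma wstar0_le C x y : x \in C -> y \in C -> x != y ->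
  wstar0 C <= enorm (x - y) ^+ 2 / 2.
Proof.
move=> xC yC xy.
pose half_sqdist (p : 'rV[R]_d * _) := enorm (p.1 - p.2) ^+ 2 / 2.
apply/seqmin_le/(map_f half_sqdist (x := (x, y))).
by rewrite mem_filter xy; exact: allpairs_f.
Qed.

Lemma wstar0_gt0 C x y : x \in C -> y \in C -> x != y -> 0 < wstar0 C.
Proof.
move=> xC yC xy; rewrite /wstar0; set pairs := [seq p <- _ | _].
have : (x, y) \in pairs by rewrite mem_filter xy; exact: allpairs_f.
have : {in pairs, forall p, p.1 != p.2}.
  by move=> p; rewrite mem_filter => /andP[].
case: pairs => // p0 pairs distinct _.
have /mapP[p /distinct p12 ->] :=
  @seqmin_mem R [seq enorm (p.1 - p.2) ^+ 2 / 2 | p <- p0 :: pairs] isT.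
by rewrite divr_gt0// exprn_gt0// lt0r enorm_eq0 subr_eq0 p12 enorm_ge0.
Qed.

End FirstCenters.

Lemma uniq_pigeonhole (T : eqType) (I : finType) (g : T -> I) (s : seq T) :
  uniq s -> (#|I| < size s)%N ->
  exists x y, [/\ x \in s, y \in s, x != y & g x = g y].
Proof.
move=> us; rewrite ltnNge; apply: contraNP => no_collision.
rewrite -(size_map g); have /card_uniqP<- : uniq (map g s).
  rewrite map_inj_in_uniq// => x y xs ys gxy; apply: contrapT => /eqP xy.
  by apply: no_collision; exists x, y.
exact: max_card.
Qed.

Lemma wstar0_bounds (R : realType) (d k : nat) (c : 'I_k -> 'rV[R]_d)
    (g : 'rV[R]_d -> 'I_k) (C : seq 'rV[R]_d) :
  uniq C -> (k < size C)%N -> 0 < wstar0 C <= clustering_cost c g C.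
Proof.
move=> uC; rewrite -[X in (X < _)%N]card_ord => /(uniq_pigeonhole g uC).
move=> [x [y [xC yC xy gxy]]]; rewrite (wstar0_gt0 xC yC xy)/=.
have yCx : y \in rem x C by rewrite mem_rem_uniq// !inE eq_sym xy.
rewrite (clustering_cost_rem _ _ xC) (clustering_cost_rem _ _ yCx) -gxy.
have := wstar0_le xC yC xy.
have := @sqr_enormB_le R d 1 x y (c (g x)) ltr01.
have := clustering_cost_ge0 c g (rem y (rem x C)).
by rewrite invr1; lra.
Qed.

Lemma kmeans_opt_assignment (R : realType) (d k n : nat)
    (v : n.-tuple 'rV[R]_d) :
  (0 < k)%N ->
  exists (c : 'I_k -> 'rV[R]_d) (g : 'rV[R]_d -> 'I_k),
    clustering_cost c g v <= kmeans_opt k v.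
Proof.
move=> k0; have [a [c [-> _]]] := kmeans_opt_attained v k0.
pose g x := [arg min_(i < Ordinal k0) enorm (x - c i) ^+ 2]%O.
exists c, g; rewrite /clustering_cost big_tuple /kmeans_cost.
rewrite (partition_big a xpredT)//=.
apply: ler_sum => i _; apply: ler_sum => t _.
by rewrite /g; case: arg_minP => //= j _; apply.
Qed.

Section InitialState.
Variables (R : realType) (d k n : nat).
Variables (c : 'I_k -> 'rV[R]_d) (g : 'rV[R]_d -> 'I_k) (W : R).
Variables C s : seq 'rV[R]_d.
Hypotheses (k_gt0 : (0 < k)%N) (C_uniq : uniq C) (C_size : size C = k.+1).
Hypothesis length_le : (size (C ++ s) <= n)%N.
Hypothesis cost_le : clustering_cost c g (C ++ s) <= W.

Let K_gt0 : 0 < k%:R :> R.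
Proof. by rewrite ltr0n. Qed.

Let w_bounds : 0 < wstar0 C <= clustering_cost c g C.
Proof. by apply: wstar0_bounds; rewrite ?C_size. Qed.

Let W_gt0 : 0 < W.
Proof.
have /andP[w0 wC] := w_bounds; apply: lt_le_trans cost_le.
by rewrite clustering_cost_cat ltr_wpDr ?clustering_cost_ge0 ?(lt_le_trans w0).
Qed.

Lemma run_invariant_init : run_invariant n c g W (init_state k C) s 0.
Proof.
have [/andP[w0 _] Cs] := (w_bounds, length_le).
rewrite size_cat C_size in Cs; split=> //=; [|by case: (C) C_size| | |].
- by rewrite divr_gt0.
- by rewrite !mulr_ge0 ?addr_ge0 ?log2_ge0// ler1n (leq_trans _ Cs).
- move=> v vs; apply: le_trans cost_le.
  by rewrite (@clustering_cost_rem _ _ _ _ _ v) ?mem_cat ?vs ?orbT// lerDl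
    clustering_cost_ge0.
- exact: ledger0.
Qed.

Lemma potential_init_le :
  potential n c g W (init_state k C) s 0 <=
    22 * W / k%:R * phase_capacity R k n.
Proof.
have /andP[_ wC] := w_bounds; have T1 := phase_capacity_ge1 run_invariant_init.
move: cost_le; rewrite clustering_cost_cat => CsW.
rewrite /potential /reserve /= subr0 mulr0 add0r.
set T := phase_capacity _ _ _; set S := clustering_cost c g s.
have Wk : W / k.+1%:R <= W / 2.
  by rewrite ler_pM2l// lef_pV2 ?posrE ?ltr0n// ler_nat.
rewrite (_ : _ + _ = (wstar0 C + 2 * (9 * S + 4 * (W / k.+1%:R))) / k%:R * T).
  rewrite !ler_pM2r ?invr_gt0//; last by rewrite (lt_le_trans _ T1).
  have := clustering_cost_ge0 c g C; move: Wk CsW wC.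
  by rewrite -/S; set r := W / _; lra.
by field; rewrite !gt_eqF//= ltr0n.
Qed.

Lemma expected_cost_init_le :
  expected_cost k (init_state k C) s <=
    22 * W / k%:R * phase_capacity R k n.
Proof.
apply: le_trans potential_init_le.
exact: expected_cost_le_potential run_invariant_init.
Qed.

End InitialState.

Lemma phase_capacity_le (R : realType) (k n : nat) : (0 < k)%N -> (1 < n)%N ->
  phase_capacity R k n <= 7 * k%:R * log2 n%:R.
Proof.
move=> k0 n1; have k1 : 1 <= k%:R :> R by rewrite ler1n.
have L1 : 1 <= log2 n%:R :> R.
  by rewrite -[leLHS]/(1%:R) -(log2X R 1) ler_log2// ler_nat.
have : k%:R <= k%:R * log2 n%:R :> R by rewrite ler_peMr// ltW.
by rewrite /phase_capacity /opening_quota; lra.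
Qed.

Theorem theorem4 (R : realType) :
  exists2 A : R, 0 < A &
  forall (d k n : nat) (v : n.-tuple 'rV[R]_d),
    (1 <= k)%N ->
    (k.+1 <= size (undup v))%N ->
    expect (online_kmeans k v) (@assignment_cost R d)
      <= A * (kmeans_opt k v * log2 n%:R).
Proof.
exists 154 => // d k n v k0 kv.
have n1 : (1 < n)%N.
  by rewrite -(size_tuple v) (leq_trans _ (size_undup v))// (leq_trans _ kv).
have [c [g optW]] := kmeans_opt_assignment v k0.
set W := kmeans_opt k v in optW *.
have W0 : 0 <= W := le_trans (clustering_cost_ge0 c g v) optW.
have perm := perm_split_stream k.+1 [::] v.
have uC := @split_stream_uniq R d k.+1 [::] v isT.
have sC : size (split_stream k.+1 [::] v).1 = k.+1.
  by rewrite size_split_stream// (minn_idPl kv).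
have -> : 154 * (W * log2 n%:R) = 22 * W / k%:R * (7 * k%:R * log2 n%:R).
  by field; rewrite pnatr_eq0 -lt0n.
rewrite expect_online_kmeansE.
apply: le_trans (_ : _ <= 22 * W / k%:R * phase_capacity R k n) _.
  apply: (expected_cost_init_le k0 uC sC (c := c) (g := g)).
    by rewrite (perm_size perm) size_tuple.
  by rewrite (perm_clustering_cost c g perm).
by rewrite ler_wpM2l ?phase_capacity_le// divr_ge0// mulr_ge0.
Qed.
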